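(* Let $n\ge 0$ be a fixed integer and let $y\in[0,1]$ be fixed with $y\neq p$. Then, as $N\to\infty$ with $x=yN$, $$K_n(x)\sim \frac{N^{n}}{n!}\,(y-p)^{n},$$ i.e. the ratio of the two sides tends to $1$.
   Context: Fix real $0<p,q<1$ with $p+q=1$. For integers $n,N\ge 0$ and real $x$, the Krawtchouk polynomial is $$K_n(x)=K_n(x,N,p,q)=\sum_{k=0}^{n}\binom{x}{k}\binom{N-x}{n-k}q^{k}(-p)^{n-k},$$ where $\binom{a}{k}=a(a-1)\cdots(a-k+1)/k!$ for real $a$ and integer $k\geq 0$. *)

(* Defs.v *)
From mathcomp Require Import all_boot all_order all_algebra.
From mathcomp Require Import all_classical all_reals all_analysis.

Set Implicit Arguments.
Unset Strict Implicit.
Unset Printing Implicit Defensive.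

Import Order.TTheory GRing.Theory Num.Theory.
Import numFieldNormedType.Exports.

Local Open Scope ring_scope.

Definition gbinom (R : realType) (a : R) (k : nat) : R :=
  (\prod_(i < k) (a - i%:R)) / k`!%:R.

Definition krawtchouk (R : realType) (p q : R) (N n : nat) (x : R) : R :=
  \sum_(k < n.+1)
    gbinom x k * gbinom (N%:R - x) (n - k) * q ^+ k * (- p) ^+ (n - k).

(* Main.v *)
Require Import Defs.
From mathcomp Require Import all_boot all_order all_algebra.
From mathcomp Require Import all_classical all_reals all_analysis.
From mathcomp Require Import ring.

Import Order.TTheory GRing.Theory Num.Theory.
Import numFieldNormedType.Exports.

Local Open Scope classical_set_scope.
Local Open Scope ring_scope.

(** Both upper arguments of the generalized binomials in the Krawtchouk sum are
    fixed multiples of N, namely y N and (1 - y) N, and the binomial of a N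
    over k is a polynomial in N with leading term (a N)^k / k!
    ([cvg_gbinom_div]).  Every summand is therefore O(N^n), and after
    division by N^n the sum converges termwise to
    [\sum_k (q y)^k / k! * (- p (1 - y))^(n - k) / (n - k)!],
    which the binomial theorem collapses to (q y - p (1 - y))^n / n!
    ([cvg_krawtchouk_div]).  Since p + q = 1, the base q y - p (1 - y) is y - p;
    it is nonzero, so dividing by this limit gives the ratio 1.

    Sequences are indexed by N.+1, so that division by N is exact at every
    index; this shift does not change the limit. *)

(** Dividing each of the k factors a N - i by N leaves a - i / N, which tends
    to a; the number of factors does not depend on N. *)
Lemma cvg_gbinom_div (R : realType) (a : R) (k : nat) :
  gbinom (a * N.+1%:R) k / N.+1%:R ^+ k @[N --> \oo] --> a ^+ k / k`!%:R.
Proof.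
have eq_gbinom N : (\prod_(i < k) (a - i%:R * N.+1%:R^-1)) / k`!%:R =
    gbinom (a * N.+1%:R) k / N.+1%:R ^+ k.
  rewrite /gbinom mulrAC; congr (_ / _).
  rewrite -[X in _ ^+ X]card_ord -prodr_const -prodf_div.
  apply: eq_bigr => i _.
  by rewrite mulrBl mulfK // pnatr_eq0.
under eq_cvg do rewrite -eq_gbinom.
apply: cvgMr_tmp; rewrite -[X in a ^+ X]card_ord -prodr_const.
apply: cvg_big => [|i _]; first exact: mul_continuous.
rewrite -[X in _ --> X]subr0 -[X in a - X](mulr0 i%:R).
by apply: cvgB; [exact: cvg_cst | apply: cvgMl_tmp; exact: cvg_harmonic].
Qed.

(** The exponential form of the binomial theorem, in which 1 / k! and
    1 / (n - k)! appear as they do in the limits of the two generalized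
    binomials. *)
Lemma exprDn_div_fact (R : numFieldType) (x y : R) (n : nat) :
  (x + y) ^+ n / n`!%:R =
  \sum_(k < n.+1) x ^+ k / k`!%:R * (y ^+ (n - k) / (n - k)`!%:R).
Proof.
rewrite addrC exprDn mulr_suml; apply: eq_bigr => k _.
have le_kn : (k <= n)%N by rewrite -ltnS.
have fact_neq0 m : m`!%:R != 0 :> R by rewrite pnatr_eq0 -lt0n fact_gt0.
have bin_neq0 : 'C(n, k)%:R != 0 :> R by rewrite pnatr_eq0 -lt0n bin_gt0.
rewrite -(bin_fact le_kn) !natrM -mulr_natr.
by field; rewrite bin_neq0 !fact_neq0.
Qed.

Lemma cvg_krawtchouk_div (R : realType) (p q y : R) (n : nat) :
  krawtchouk p q N.+1 n (y * N.+1%:R) / N.+1%:R ^+ n @[N --> \oo] -->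
  (q * y - p * (1 - y)) ^+ n / n`!%:R.
Proof.
pose b a k N : R := gbinom (a * N.+1%:R) k / N.+1%:R ^+ k.
have eq_krawtchouk N :
    \sum_(k < n.+1) b y k N * b (1 - y) (n - k)%N N *
      (q ^+ k * (- p) ^+ (n - k)) =
    krawtchouk p q N.+1 n (y * N.+1%:R) / N.+1%:R ^+ n.
  rewrite /krawtchouk mulr_suml; apply: eq_bigr => k _.
  have le_kn : (k <= n)%N by rewrite -ltnS.
  have N_neq0 m : N.+1%:R ^+ m != 0 :> R by rewrite expf_neq0 // pnatr_eq0.
  have -> : N.+1%:R ^+ n = N.+1%:R ^+ k * N.+1%:R ^+ (n - k) :> R.
    by rewrite -exprD subnKC.
  rewrite /b.
  rewrite (_ : N.+1%:R - _ = (1 - y) * N.+1%:R); last by rewrite mulrBl mul1r.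
  by field; rewrite !N_neq0.
under eq_cvg do rewrite -eq_krawtchouk.
rewrite -mulNr exprDn_div_fact.
apply: cvg_big => [|k _]; first exact: add_continuous.
have <- : y ^+ k / k`!%:R * ((1 - y) ^+ (n - k) / (n - k)`!%:R) *
    (q ^+ k * (- p) ^+ (n - k)) =
    (q * y) ^+ k / k`!%:R * ((- p * (1 - y)) ^+ (n - k) / (n - k)`!%:R).
  by rewrite !exprMn; ring.
by apply: cvgMr_tmp; apply: cvgM; exact: cvg_gbinom_div.
Qed.

Theorem mainTheorem1 (R : realType) (p q : R)
    (hp : 0 < p < 1) (hq : 0 < q < 1) (hpq : p + q = 1)
    (n : nat) (y : R) (hy : 0 <= y <= 1) (hyp : y != p) :
  (fun N : nat => krawtchouk p q N n (y * N%:R) /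
                  (N%:R ^+ n / n`!%:R * (y - p) ^+ n)) @ \oo --> (1 : R).
Proof.
pose L : R := (y - p) ^+ n / n`!%:R.
have L_neq0 : L != 0.
  by rewrite mulf_neq0 ?invr_eq0 ?expf_neq0 ?subr_eq0 // pnatr_eq0 -lt0n fact_gt0.
have base_eq : q * y - p * (1 - y) = y - p.
  have -> : q = 1 - p by rewrite -hpq addrC addKr.
  by ring.
rewrite -cvg_shiftS /=.
have eq_ratio N : krawtchouk p q N.+1 n (y * N.+1%:R) / N.+1%:R ^+ n / L =
    krawtchouk p q N.+1 n (y * N.+1%:R) /
    (N.+1%:R ^+ n / n`!%:R * (y - p) ^+ n).
  by rewrite -mulrA -invfM /L; congr (_ / _); ring.
under eq_cvg do rewrite -eq_ratio.
have := @cvgMr_tmp _ _ _ _ _ _ L^-1 (cvg_krawtchouk_div _ p q y n).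
by rewrite base_eq (divff L_neq0) => ratio_cvg; exact: ratio_cvg.
Qed.
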